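(* Let $W=(w_{ij})$ be a real symmetric $n\times n$ matrix, let $a_1,\dots,a_n$ be positive real numbers, and set $\bar v_{ij}=\frac{a_j-a_i}{a_j+a_i}$ for all $1\le i,j\le n$. Let $T:\mathbb{R}^n\to\mathbb{R}^n$ be the linear operator defined by $$(T\mathbf{y})_i=\sum_{j=1}^n\left[y_i-y_j-\bar v_{ij}(y_i+y_j)\right]w_{ij},\qquad 1\le i\le n.$$ Let $c>0$ and $X=\mathrm{diag}(ca_1,\dots,ca_n)$. Then $T$ is self-adjoint with respect to the inner product $\langle\cdot,\cdot\rangle_X$, i.e. $\langle T\mathbf{y},\mathbf{z}\rangle_X=\langle \mathbf{y},T\mathbf{z}\rangle_X$ for all $\mathbf{y},\mathbf{z}\in\mathbb{R}^n$.
   Context: For a positive definite real $n\times n$ matrix $A$, $\langle \mathbf{y},\mathbf{z}\rangle_A:=\mathbf{y}^tA\mathbf{z}$ for $\mathbf{y},\mathbf{z}\in\mathbb{R}^n$. *)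

(* Defs.v *)
From HB Require Import structures.
From mathcomp Require Import all_boot all_order all_algebra.
From mathcomp Require Import reals ring.

Set Implicit Arguments.
Unset Strict Implicit.
Unset Printing Implicit Defensive.

Import Order.TTheory GRing.Theory Num.Theory.
Local Open Scope ring_scope.

(* <y, z>_A = y^t A z; it is an inner product when A is positive definite. *)
Definition inner (R : realType) (n : nat) (A : 'M[R]_n) (y z : 'cV[R]_n) : R :=
  (y^T *m A *m z) 0 0.

Definition posdefmx (R : realType) (n : nat) (A : 'M[R]_n) : Prop :=
  A^T = A /\ forall y : 'cV[R]_n, y != 0 -> 0 < inner A y y.

Definition vbar (R : realType) (n : nat) (a : 'I_n -> R) (i j : 'I_n) : R :=
  (a j - a i) / (a j + a i).

Definition opT (R : realType) (n : nat) (W : 'M[R]_n) (a : 'I_n -> R)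
    (y : 'cV[R]_n) : 'cV[R]_n :=
  \col_i \sum_(j < n)
    (y i 0 - y j 0 - vbar a i j * (y i 0 + y j 0)) * W i j.

Definition diagX (R : realType) (n : nat) (c : R) (a : 'I_n -> R) : 'M[R]_n :=
  diag_mx (\row_i (c * a i)).

Fact opT_is_linear (R : realType) (n : nat) (W : 'M[R]_n) (a : 'I_n -> R) :
  linear (opT W a).
Proof.
move=> k y z; apply/matrixP => i j; rewrite !mxE mulr_sumr -big_split /=.
apply: eq_bigr => l _; rewrite !mxE mulrA -mulrDl; congr (_ * _).
by ring.
Qed.

HB.instance Definition _ (R : realType) (n : nat) (W : 'M[R]_n)
    (a : 'I_n -> R) :=
  GRing.isLinear.Build R 'cV[R]_n 'cV[R]_n _ (opT W a) (opT_is_linear W a).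

Fact diagX_posdef (R : realType) (n : nat) (c : R) (a : 'I_n -> R) :
  0 < c -> (forall i, 0 < a i) -> posdefmx (diagX c a).
Proof.
move=> c0 a0; split=> [|y y0]; first exact: tr_diag_mx.
have e0 i : 0 <= y i 0 * (c * a i) * y i 0.
  by rewrite mulrAC -expr2 mulr_ge0 ?sqr_ge0 // ltW // mulr_gt0.
have -> : inner (diagX c a) y y = \sum_i y i 0 * (c * a i) * y i 0.
  rewrite /inner mul_mx_diag mxE; apply: eq_bigr => i _.
  by rewrite !mxE.
rewrite lt_def sumr_ge0 // andbT; apply: contraNneq y0 => s0.
apply/eqP/matrixP => i j; rewrite (ord1 j) mxE; apply/eqP.
have /eqP := psumr_eq0P (fun i _ => e0 i) s0 (i := i) isT.
by rewrite !mulf_eq0 (gt_eqF c0) (gt_eqF (a0 i)) /= orbF orbb.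
Qed.

(* Main.v *)
Require Import Defs.
From mathcomp Require Import all_boot all_order all_algebra.
From mathcomp Require Import reals.
From mathcomp Require Import ring.

(* Since 1 - vbar_ij = 2 a_i / (a_i + a_j) and 1 + vbar_ij = 2 a_j / (a_i + a_j),
   the form <T y, z>_X splits into a diagonal form, symmetric in y and z, minus
   the bilinear form with kernel 2 c w_ij a_i a_j / (a_i + a_j), which is
   symmetric because W is. *)

Set Implicit Arguments.
Unset Strict Implicit.
Unset Printing Implicit Defensive.

Import GRing.Theory Num.Theory.
Local Open Scope ring_scope.

Lemma inner_diagX (R : realType) (n : nat) (c : R) (a : 'I_n -> R)
    (y z : 'cV[R]_n) :
  inner (diagX c a) y z = \sum_i c * a i * y i 0 * z i 0.
Proof.
rewrite /inner mul_mx_diag mxE; apply: eq_bigr => i _.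
by rewrite !mxE [y i 0 * _]mulrC.
Qed.

Lemma inner_diagX_sym (R : realType) (n : nat) (c : R) (a : 'I_n -> R)
    (y z : 'cV[R]_n) :
  inner (diagX c a) y z = inner (diagX c a) z y.
Proof. by rewrite !inner_diagX; apply: eq_bigr => i _; rewrite mulrAC. Qed.

Lemma inner_opT (R : realType) (n : nat) (W : 'M[R]_n) (a : 'I_n -> R)
    (c : R) (y z : 'cV[R]_n) (a_gt0 : forall i : 'I_n, 0 < a i) :
  inner (diagX c a) (opT W a y) z =
    \sum_i \sum_j 2 * c * W i j * a i * a i / (a j + a i) * (y i 0 * z i 0)
    - \sum_i \sum_j 2 * c * W i j * (a i * a j) / (a j + a i)
                      * (z i 0 * y j 0).
Proof.
rewrite inner_diagX -sumrB; apply: eq_bigr => i _.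
rewrite mxE mulr_sumr mulr_suml -sumrB; apply: eq_bigr => j _.
have aji_neq0 : a j + a i != 0 by rewrite lt0r_neq0 ?addr_gt0.
(* The bracket in [opT] is [(1 - vbar a i j) * y i 0 - (1 + vbar a i j) * y j 0]: its first term
   gives the diagonal form, its second the kernel. *)
by rewrite /vbar; field.
Qed.

Theorem theorem3p1 (R : realType) (n : nat) (W : 'M[R]_n) (a : 'I_n -> R)
    (c : R) (W_sym : W^T = W) (a_gt0 : forall i : 'I_n, 0 < a i)
    (c_gt0 : 0 < c) :
  forall y z : 'cV[R]_n,
    inner (diagX c a) (opT W a y) z = inner (diagX c a) y (opT W a z).
Proof.
(* Moving [opT W a z] to the left slot lets one expansion serve both sides, with [y] and [z]
   exchanged. *)
move=> y z; rewrite [RHS]inner_diagX_sym !inner_opT //; congr (_ - _).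
  by apply: eq_bigr => i _; apply: eq_bigr => j _; rewrite [y i 0 * _]mulrC.
(* Swapping the summation indices transposes the kernel, which symmetry of [W] leaves unchanged. *)
rewrite exchange_big; apply: eq_bigr => i _; apply: eq_bigr => j _ /=.
have -> : W j i = W i j by rewrite -[in LHS]W_sym mxE.
by rewrite [a j * a i]mulrC [a i + a j]addrC [z j 0 * _]mulrC.
Qed.
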